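(* For each $n\in\mathbb{N}$ let $\varepsilon_n>0$ be such that $\|T^*T-T_n^*T_n\|\le \varepsilon_n$. Then for every $n\in\mathbb{N}$ and every $\alpha>0$, $$\|x^\dagger-x_n^\dagger\|\le\Big(1+\frac{\varepsilon_n}{\alpha}\Big)\|x^\dagger-x_\alpha\|.$$ In particular, the following hold. (1) $\|x^\dagger-x_n^\dagger\|\le 2\,\|x^\dagger-x_{\varepsilon_n}\|$ for every $n\in\mathbb{N}$. (2) If $\|T^*T-T_n^*T_n\|\to0$ as $n\to\infty$, then $\|x^\dagger-x_n^\dagger\|\to0$ as $n\to\infty$.
   Context: Setting: $X$ and $Y$ are Hilbert spaces over $\mathbb{K}\in\{\mathbb{R},\mathbb{C}\}$ and $T:X\to Y$ is a bounded linear operator with range $R(T)$. $Z$ is a linear subspace of $Y$ with $R(T)\subseteq Z$, and $y\in R(T)$. For each $n\in\mathbb{N}$, $Y_n$ is a finite dimensional inner product space over $\mathbb{K}$ and $\pi_n:Z\to Y_n$ is a linear operator (not assumed bounded) such that $T_n:=\pi_nT:X\to Y_n$ is a bounded linear operator. Put $y_n:=\pi_ny$. Adjoints are Hilbert space adjoints, $T^*:Y\to X$ and $T_n^*:Y_n\to X$, and norms of operators are operator norms. $x^\dagger:=T^\dagger y$ is the unique element of minimal norm among the solutions $x\in X$ of $Tx=y$ (equivalently, the solution lying in $N(T)^\perp$, where $N(T)$ is the null space of $T$). $x_n^\dagger$ is the unique element of minimal norm among the solutions $x\in X$ of $T_nx=y_n$ (equivalently, the solution lying in $N(T_n)^\perp$).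 For $\alpha>0$, $x_\alpha\in X$ is the Tikhonov regularized solution, i.e. the unique solution of $(T^*T+\alpha I)x_\alpha=T^*y$; $x_{\varepsilon_n}$ denotes $x_\alpha$ with $\alpha=\varepsilon_n$. *)

(* Defs.v *)
From HB Require Import structures.
From mathcomp Require Import all_boot all_order all_algebra.
From mathcomp Require Import complex.
From mathcomp Require Import all_classical all_reals all_analysis.

Set Implicit Arguments.
Unset Strict Implicit.
Unset Printing Implicit Defensive.

Import Order.TTheory GRing.Theory Num.Theory.
Import numFieldNormedType.Exports.

Local Open Scope classical_set_scope.
Local Open Scope ring_scope.

(* K is either R or C; a theorem quantified over [k : scalar_kind] covers both
   cases. *)
Variant scalar_kind := RealScalars | ComplexScalars.

Definition scalars (R : realType) (k : scalar_kind) : numFieldType :=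
  match k with RealScalars => R | ComplexScalars => R[i] end.

Definition sconj (R : realType) (k : scalar_kind) :
    scalars R k -> scalars R k :=
  match k with
  | RealScalars => fun a : R => a
  | ComplexScalars => fun z : R[i] => Num.conj z
  end.

Definition of_real (R : realType) (k : scalar_kind) : R -> scalars R k :=
  match k with
  | RealScalars => fun a : R => a
  | ComplexScalars => fun a : R => real_complex R a
  end.

Definition re_part (R : realType) (k : scalar_kind) : scalars R k -> R :=
  match k with
  | RealScalars => fun a : R => a
  | ComplexScalars => fun z : R[i] => complex.Re z
  end.

Section HilbertSpaceNotions.
Variables (R : realType) (k : scalar_kind).
Local Notation K := (scalars R k).

(* The norm of a normedModType over K is a nonnegative element of K; this is
   the same norm, read as an element of R. *)
Definition rnorm (V : normedModType K) (x : V) : R := re_part `|x|.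

(* Inner products are linear in the first variable and conjugate-linear in the
   second.  A Hilbert space over K is a completeNormedModType K with an inner
   product satisfying this predicate. *)
Definition norm_from_dot (V : normedModType K) (d : {dot V for @sconj R k}) :=
  forall x : V, `|x| ^+ 2 = d x x.

Definition finite_dimensional (V : lmodType K) :=
  exists (m : nat) (b : 'I_m -> V),
    forall v : V, exists c : 'I_m -> K, v = \sum_(i < m) c i *: b i.

Definition bounded_operator (V W : normedModType K) (A : V -> W) :=
  exists M : R, forall x : V, rnorm (A x) <= M * rnorm x.

(* Only meaningful for bounded operators: [sup] is 0 on unbounded sets. *)
Definition opnorm (V W : normedModType K) (A : V -> W) : R :=
  sup [set rnorm (A x) | x in [set x : V | rnorm x <= 1]].

(* By Riesz representation, a bounded linear A from a Hilbert space V has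
   exactly one such B when W is a Hilbert space. *)
Definition is_adjoint (V W : normedModType K)
    (dV : {dot V for @sconj R k}) (dW : {dot W for @sconj R k})
    (A : V -> W) (B : W -> V) :=
  forall (x : V) (w : W), dW (A x) w = dV x (B w).

Definition is_min_norm_solution (V : normedModType K) (W : Type)
    (A : V -> W) (b : W) (x : V) :=
  A x = b /\ forall x' : V, A x' = b -> rnorm x <= rnorm x'.

Definition is_tikhonov (V W : normedModType K) (A : V -> W) (B : W -> V)
    (b : W) (a : R) (x : V) :=
  B (A x) + of_real k a *: x = B b.

(* The composition of A, whose values lie in the subspace S, with a map p
   defined only on S.  Z is the subtype of W carved out by S; its structure makes
   [val : Z -> W] linear, so S is necessarily a linear subspace. *)
Definition comp_on (V W W' : lmodType K) (S : pred W)
    (Z : subLmodType S) (A : V -> W) (hA : forall x, A x \in S) (p : Z -> W') :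
    V -> W' :=
  fun x => p (Sub (A x) (hA x)).

End HilbertSpaceNotions.

(* Main.v *)
Require Import Defs.
From HB Require Import structures.
From mathcomp Require Import all_boot all_order all_algebra.
From mathcomp Require Import complex.
From mathcomp Require Import all_classical all_reals all_analysis.
From mathcomp Require Import ring lra.

Set Implicit Arguments.
Unset Strict Implicit.
Unset Printing Implicit Defensive.

Import Order.TTheory GRing.Theory Num.Theory.
Import numFieldNormedType.Exports.

Local Open Scope classical_set_scope.
Local Open Scope ring_scope.

(** Write [x] for the minimal norm solution of [T x = y], [x'] for that of
    [T_n x' = y_n], [x_a] for the Tikhonov solution, and [u := x - x'].

    Since [T_n x = y_n], the element [u] lies in [N(T_n)], and [x'] is
    orthogonal to [N(T_n)] by minimality.  Hence
      [|u|^2 = <x, u> = <x - x_a, u> + <x_a, u>].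
    The Tikhonov equation says [a x_a = T* T (x - x_a)], and
    [<T_n* T_n (x - x_a), u> = <T_n (x - x_a), T_n u> = 0], so that
      [a <x_a, u> = <(T* T - T_n* T_n) (x - x_a), u>]
    which is at most [|T* T - T_n* T_n| |x - x_a| |u|].  Dividing by [|u|] gives
    the main bound ([min_norm_error_le]), in fact with the operator norm itself
    in place of [eps n].  Taking [a := eps n] gives (1).

    For (2) the operator norms tend to [0] but the [eps n] need not, so [a] is
    chosen independently of [n]: as soon as the operator norm is below [a] the
    bound is at most [2 |x - x_a|].  It remains to know that [x_a] tends to [x]
    when [a] tends to [0] ([tikhonov_cvg]).  Subtracting two Tikhonov equations
    yields [|x_a - x_c|^2 <= |x_a|^2 - |x_c|^2] for [a <= c]
    ([rnorm_tikhonovB_sqr_le]); the norms are bounded by [|x|], so [x_a] is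
    Cauchy.  Its limit [l] solves [T l = y], because
    [<T (x - x_a), T v> = a <x_a, v>] tends to [0].  Finally [x] and every [x_a]
    are orthogonal to [N(T)], hence so is [x - l], which also lies in [N(T)].

    Every inner product above is used through its real part [rdot], a real inner
    product inducing the same norm, for which adjoints remain adjoints; this
    treats real and complex scalars at once. *)

(** * Real and complex scalars *)

Section RealPart.
Variables (R : realType) (k : scalar_kind).
Implicit Types (a b : R) (z w : scalars R k).

Lemma re_partD z w : re_part (z + w) = re_part z + re_part w.
Proof. by case: k z w => //= -[? ?] []. Qed.

Lemma re_part_conj z : re_part (sconj z) = re_part z.
Proof. by case: k z => //= -[]. Qed.

Lemma re_part_of_realM a z : re_part (of_real k a * z) = a * re_part z.
Proof. by case: k z => //= -[x y] /=; rewrite mul0r subr0. Qed.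

Lemma of_realM a b : of_real k (a * b) = of_real k a * of_real k b.
Proof. by case: k => //=; rewrite rmorphM. Qed.

Lemma of_real0 : of_real k 0 = 0 :> scalars R k.
Proof. by case: k => //=; rewrite rmorph0. Qed.

Lemma re_part_of_real a : re_part (of_real k a) = a.
Proof. by case: k. Qed.

Lemma le_of_real a b : (of_real k a <= of_real k b) = (a <= b).
Proof. by case: k => //=; rewrite lecR. Qed.

Lemma lt_of_real a b : (of_real k a < of_real k b) = (a < b).
Proof. by case: k => //=; rewrite ltcR. Qed.

Lemma of_real_re_part z : 0 <= z -> of_real k (re_part z) = z.
Proof. by case: k z => //= z z0; rewrite RRe_real ?ger0_real. Qed.

Lemma re_part_gt0 z : 0 < z -> 0 < re_part z.
Proof.
by move=> z0; rewrite -lt_of_real of_real0 of_real_re_part// ltW.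
Qed.

End RealPart.

(** * The real inner product underlying a Hilbert space *)

Section RealInnerProduct.
Variables (R : realType) (k : scalar_kind).
Local Notation K := (scalars R k).
Variable V : normedModType K.
Implicit Types (x y z : V) (a : R).

Lemma rnormE x : of_real k (rnorm x) = `|x|.
Proof. by rewrite of_real_re_part. Qed.

Lemma rnorm_ge0 x : 0 <= rnorm x.
Proof. by rewrite -(le_of_real k) of_real0 rnormE. Qed.

Lemma rnorm_eq0 x : rnorm x = 0 -> x = 0.
Proof. by move=> x0; apply/normr0_eq0; rewrite -rnormE x0 of_real0. Qed.

Lemma rnorm0 : rnorm (0 : V) = 0.
Proof. by rewrite /rnorm normr0 -of_real0 re_part_of_real. Qed.

Lemma rnormN x : rnorm (- x) = rnorm x.
Proof. by rewrite /rnorm normrN. Qed.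

Lemma rnorm_distC x y : rnorm (x - y) = rnorm (y - x).
Proof. by rewrite -rnormN opprB. Qed.

Lemma ler_rnormD x y : rnorm (x + y) <= rnorm x + rnorm y.
Proof.
rewrite -(le_of_real k) rnormE (le_trans (ler_normD _ _))//.
by rewrite /rnorm -re_partD of_real_re_part ?addr_ge0.
Qed.

(** Convergence in [V] is measured by scalars, possibly complex; this moves it
    to the real line, where order arguments on limits are available. *)
Lemma cvg_rnormP (I : Type) (F : set_system I) {FF : Filter F} (f : I -> V) x :
  f @ F --> x <-> (fun i => rnorm (x - f i)) @ F --> (0 : R).
Proof.
split=> /cvgrPdist_le fx; apply/cvgrPdist_le => e e0.
- have /fx : 0 < of_real k e by rewrite -(of_real0 R k) lt_of_real.
  apply: filterS => i.
  by rewrite -rnormE le_of_real sub0r normrN ger0_norm ?rnorm_ge0.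
- have /fx := re_part_gt0 e0; apply: filterS => i.
  rewrite -rnormE -{2}(of_real_re_part (ltW e0)) le_of_real.
  by rewrite sub0r normrN ger0_norm ?rnorm_ge0.
Qed.

Definition rdot (d : {dot V for @sconj R k}) x y : R := re_part (d x y).

Variable d : {dot V for @sconj R k}.

Lemma rdotDl x y z : rdot d (x + y) z = rdot d x z + rdot d y z.
Proof. by rewrite /rdot linearDl re_partD. Qed.

Lemma rdotZl a x y : rdot d (of_real k a *: x) y = a * rdot d x y.
Proof. by rewrite /rdot linearZl_LR /= re_part_of_realM. Qed.

Lemma rdotC x y : rdot d x y = rdot d y x.
Proof.
by rewrite /rdot [d x y]hermitian_subproof expr0 mul1r re_part_conj.
Qed.

Lemma rdot0l y : rdot d 0 y = 0.
Proof. by have := rdotZl 0 0 y; rewrite scaler0 mul0r. Qed.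

Lemma rdotNl x y : rdot d (- x) y = - rdot d x y.
Proof. by apply/eqP; rewrite -addr_eq0 -rdotDl addNr rdot0l. Qed.

Lemma rdotBl x y z : rdot d (x - y) z = rdot d x z - rdot d y z.
Proof. by rewrite rdotDl rdotNl. Qed.

Lemma rdotDr x y z : rdot d x (y + z) = rdot d x y + rdot d x z.
Proof. by rewrite rdotC rdotDl !(rdotC x). Qed.

Lemma rdotBr x y z : rdot d x (y - z) = rdot d x y - rdot d x z.
Proof. by rewrite rdotC rdotBl !(rdotC x). Qed.

Lemma rdotZr a x y : rdot d x (of_real k a *: y) = a * rdot d x y.
Proof. by rewrite rdotC rdotZl (rdotC x). Qed.

Lemma rdot0r x : rdot d x 0 = 0.
Proof. by rewrite rdotC rdot0l. Qed.

Hypothesis dE : norm_from_dot d.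

Lemma rnorm_sqr x : rnorm x ^+ 2 = rdot d x x.
Proof.
by rewrite /rdot -dE -rnormE !expr2 -of_realM re_part_of_real.
Qed.

Lemma rnorm_sqrB x y :
  rnorm (x - y) ^+ 2 = rnorm x ^+ 2 - 2 * rdot d x y + rnorm y ^+ 2.
Proof.
by rewrite !rnorm_sqr !(rdotBl, rdotBr) (rdotC y x); ring.
Qed.

(** The triangle inequality is part of the structure of a normed space, so the
    Cauchy-Schwarz inequality is read off from the expansion of its square. *)
Lemma rdot_le x y : rdot d x y <= rnorm x * rnorm y.
Proof.
have : rnorm (x + y) ^+ 2 <= (rnorm x + rnorm y) ^+ 2.
  by rewrite lerXn2r ?nnegrE ?addr_ge0 ?rnorm_ge0// ler_rnormD.
rewrite rnorm_sqr !(rdotDl, rdotDr) -!rnorm_sqr (rdotC y x).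
by move=> h; nra.
Qed.

Lemma rnormZ a x : rnorm (of_real k a *: x) = `|a| * rnorm x.
Proof.
apply/eqP; rewrite -(eqrXn2 (ltn0Sn 1)) ?mulr_ge0 ?rnorm_ge0//.
by rewrite exprMn !rnorm_sqr rdotZl rdotZr real_normK ?num_real// mulrA -expr2.
Qed.

Lemma rdot_sep x y : (forall z, rdot d z x = rdot d z y) -> x = y.
Proof.
move=> xy; apply/eqP; rewrite -subr_eq0; apply/eqP/rnorm_eq0/eqP.
by rewrite -sqrf_eq0 rnorm_sqr rdotBr xy subrr.
Qed.

(** If [rdot d x u] were nonzero, moving from [x] along the kernel direction
    [u] would shorten [x] to first order. *)
Lemma min_norm_orthogonal (W : lmodType K) (A : {linear V -> W}) b x u :
  is_min_norm_solution A b x -> A u = 0 -> rdot d x u = 0.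
Proof.
move=> [Axb xmin] Au0.
have key t : 0 <= t * (t * rnorm u ^+ 2 - 2 * rdot d x u).
  have : A (x - of_real k t *: u) = b.
    by rewrite linearB linearZ/= Au0 scaler0 subr0.
  move=> /xmin le_x.
  have : rnorm x ^+ 2 <= rnorm (x - of_real k t *: u) ^+ 2.
    by rewrite lerXn2r ?nnegrE ?rnorm_ge0.
  by rewrite rnorm_sqrB rdotZr rnormZ exprMn real_normK ?num_real//; nra.
have [u0|u0] := eqVneq (rnorm u ^+ 2) 0.
  by move/eqP: u0; rewrite sqrf_eq0 => /eqP/rnorm_eq0 ->; rewrite rdot0r.
(* the minimizer in [t] of the quadratic polynomial in [key] *)
have := key (rdot d x u / rnorm u ^+ 2).
rewrite divfK//.
have -> : rdot d x u / rnorm u ^+ 2 * (rdot d x u - 2 * rdot d x u)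
    = - (rdot d x u ^+ 2 / rnorm u ^+ 2) by ring.
rewrite oppr_ge0 => le0; apply/eqP; rewrite -sqrf_eq0.
rewrite eq_le sqr_ge0 andbT.
by move: le0; rewrite pmulr_lle0// invr_gt0 lt_neqAle eq_sym u0 sqr_ge0.
Qed.

End RealInnerProduct.

(** * Operator norms and adjoints *)

Section Operators.
Variables (R : realType) (k : scalar_kind).
Local Notation K := (scalars R k).

Lemma bounded_operator_ge0 (V W : normedModType K) (A : V -> W) :
  bounded_operator A ->
  exists2 M : R, 0 <= M & forall x, rnorm (A x) <= M * rnorm x.
Proof.
move=> [M AM]; exists `|M| => // x.
by rewrite (le_trans (AM x))// ler_wpM2r ?rnorm_ge0// ler_norm.
Qed.

(** Boundedness makes the supremum defining [opnorm] a genuine upper bound; the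
    estimate then follows by normalizing [x], a scaling by a real number. *)
Lemma rnorm_le_opnorm (V W : normedModType K)
    (dV : {dot V for @sconj R k}) (dW : {dot W for @sconj R k})
    (dVE : norm_from_dot dV) (dWE : norm_from_dot dW) (A : V -> W) :
  bounded_operator A ->
  (forall a x, A (of_real k a *: x) = of_real k a *: A x) ->
  forall x, rnorm (A x) <= opnorm A * rnorm x.
Proof.
move=> /bounded_operator_ge0[M M0 AM] AZ x.
have [x0|x0] := eqVneq (rnorm x) 0.
  by have := AM x; rewrite x0 !mulr0.
have xgt0 : 0 < rnorm x by rewrite lt_neqAle eq_sym x0 rnorm_ge0.
rewrite -ler_pdivrMr//; apply: ub_le_sup.
  exists M => _ [z /= z1 <-].
  by rewrite (le_trans (AM z))// -[leRHS]mulr1 ler_wpM2l.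
exists (of_real k (rnorm x)^-1 *: x) => /=.
  by rewrite (rnormZ dVE) gtr0_norm ?invr_gt0// mulVf.
by rewrite AZ (rnormZ dWE) gtr0_norm ?invr_gt0// mulrC.
Qed.

Section Adjoint.
Variables (V W : normedModType K).
Variables (dV : {dot V for @sconj R k}) (dW : {dot W for @sconj R k}).
Hypotheses (dVE : norm_from_dot dV) (dWE : norm_from_dot dW).
Variables (A : V -> W) (B : W -> V).
Hypothesis AB : is_adjoint dV dW A B.

Lemma rdot_adjoint x w : rdot dV x (B w) = rdot dW (A x) w.
Proof. by rewrite /rdot AB. Qed.

(** [B] is given as a bare function: its homogeneity comes from the adjunction
    and the nondegeneracy of the inner product. *)
Lemma adjointZ a w : B (of_real k a *: w) = of_real k a *: B w.
Proof.
by apply: (rdot_sep dVE) => z; rewrite rdotZr !rdot_adjoint rdotZr.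
Qed.

(** [|B w|^2 = <A (B w), w> <= M |B w| |w|]. *)
Lemma adjoint_bounded : bounded_operator A -> bounded_operator B.
Proof.
move=> /bounded_operator_ge0[M M0 AM]; exists M => w.
have [->|Bw0] := eqVneq (rnorm (B w)) 0; first by rewrite mulr_ge0 ?rnorm_ge0.
have Bw_gt0 : 0 < rnorm (B w) by rewrite lt_neqAle eq_sym Bw0 rnorm_ge0.
rewrite -(ler_pM2l Bw_gt0) -expr2 (rnorm_sqr dVE) rdot_adjoint.
rewrite (le_trans (rdot_le dWE _ _))// mulrA [rnorm _ * M]mulrC.
by rewrite ler_wpM2r ?rnorm_ge0.
Qed.

Lemma adjoint_comp_bounded :
  bounded_operator A -> bounded_operator (fun x => B (A x)).
Proof.
move=> Ab; have [M M0 AM] := bounded_operator_ge0 Ab.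
have [N N0 BN] := bounded_operator_ge0 (adjoint_bounded Ab).
exists (N * M) => x; rewrite (le_trans (BN _))// -mulrA ler_wpM2l//.
Qed.

End Adjoint.

Lemma bounded_operatorB (V W : normedModType K) (A B : V -> W) :
  bounded_operator A -> bounded_operator B ->
  bounded_operator (fun x => A x - B x).
Proof.
move=> [M AM] [N BN]; exists (M + N) => x.
by rewrite (le_trans (ler_rnormD _ _))// rnormN mulrDl lerD.
Qed.

Section CompOn.
Variables (V W W' : lmodType K) (S : pred W) (Z : subLmodType S).
Variables (A : {linear V -> W}) (hA : forall x, A x \in S).
Variable p : {linear Z -> W'}.

Lemma comp_on_linear : linear (comp_on hA p).
Proof.
move=> c x y; rewrite /comp_on -linearP; congr (p _).
have valS z : val (Sub (A z) (hA z) : Z) = A z by exact: SubK.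
apply: val_inj; transitivity (A (c *: x + y)); first exact: valS.
transitivity (c *: val (Sub (A x) (hA x) : Z) + val (Sub (A y) (hA y) : Z)).
  by rewrite !valS linearP.
by rewrite -linearP.
Qed.

HB.instance Definition _ :=
  GRing.isLinear.Build K V W' *:%R (comp_on hA p) comp_on_linear.

End CompOn.

End Operators.

(** * Tikhonov regularization *)

Section Tikhonov.
Variables (R : realType) (k : scalar_kind).
Local Notation K := (scalars R k).
Variables (V W : normedModType K).
Variables (dV : {dot V for @sconj R k}) (dW : {dot W for @sconj R k}).
Hypotheses (dVE : norm_from_dot dV) (dWE : norm_from_dot dW).
Variables (A : {linear V -> W}) (B : W -> V).
Hypothesis AB : is_adjoint dV dW A B.

(** The weak form of [a x_a = A* A (x - x_a)], tested against [u]. *)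
Lemma tikhonov_rdot b a x xa u : A x = b -> is_tikhonov A B b a xa ->
  a * rdot dV xa u = rdot dW (A (x - xa)) (A u).
Proof.
move=> Axb /(congr1 (fun z => rdot dV u z)).
rewrite rdotDr rdotZr !(rdot_adjoint AB) -Axb (rdotC dV u) => e.
by rewrite linearB rdotBl !(rdotC dW _ (A u)) -e; ring.
Qed.

Section ErrorBound.
Variables (W' : normedModType K) (dW' : {dot W' for @sconj R k}).
Hypothesis dW'E : norm_from_dot dW'.
Variables (A' : {linear V -> W'}) (B' : W' -> V).
Hypothesis AB' : is_adjoint dV dW' A' B'.
Hypotheses (Abd : bounded_operator A) (A'bd : bounded_operator A').

(** [x'] is the orthogonal projection of [x] onto the complement of the kernel
    of [A'], so [u := x - x'] satisfies [|u|^2 = <x, u>].  With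
    [v := x - xa], adding [- <B' (A' v), u> = - <A' v, A' u> = 0] to the weak
    Tikhonov equation turns the part of [<x, u>] due to [xa] into a term
    controlled by the difference of the two normal operators. *)
Lemma min_norm_error_le x x' xa a : 0 < a ->
  is_min_norm_solution A' (A' x) x' ->
  is_tikhonov A B (A x) a xa ->
  rnorm (x - x') <=
    (1 + opnorm (fun z => B (A z) - B' (A' z)) / a) * rnorm (x - xa).
Proof.
move=> a0 x'min xaE; set N := opnorm _.
set u := x - x'; set v := x - xa.
have A'u : A' u = 0 by rewrite linearB x'min.1 subrr.
have opN : rnorm (B (A v) - B' (A' v)) <= N * rnorm v.
  apply: (rnorm_le_opnorm dVE dVE (A := fun z => B (A z) - B' (A' z))).
    by apply: bounded_operatorB;
      [apply: (adjoint_comp_bounded dVE dWE AB)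
      |apply: (adjoint_comp_bounded dVE dW'E AB')].
  move=> c z; rewrite !linearZ/= (adjointZ dVE AB) (adjointZ dVE AB').
  by rewrite scalerBr.
have uE : rnorm u ^+ 2 = rdot dV v u + rdot dV xa u.
  rewrite (rnorm_sqr dVE) {1}/u rdotBl.
  by rewrite (min_norm_orthogonal dVE x'min A'u) subr0 -rdotDl subrK.
have xau : a * rdot dV xa u <= N * rnorm v * rnorm u.
  have -> : a * rdot dV xa u = rdot dV (B (A v) - B' (A' v)) u.
    rewrite (tikhonov_rdot _ (erefl (A x)) xaE) rdotBl !(rdotC dV _ u).
    by rewrite !(rdot_adjoint AB) !(rdot_adjoint AB') A'u rdot0l subr0 rdotC.
  by rewrite (le_trans (rdot_le dVE _ _))// ler_wpM2r ?rnorm_ge0.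
have [u0|u0] := eqVneq (rnorm u) 0.
  rewrite u0 mulrDl mul1r addr_ge0 ?rnorm_ge0// mulrAC divr_ge0 ?(ltW a0)//.
  exact: le_trans (rnorm_ge0 _) opN.
have ugt0 : 0 < rnorm u by rewrite lt_neqAle eq_sym u0 rnorm_ge0.
rewrite -(ler_pM2r ugt0) -expr2 uE mulrDl mulrDl mul1r lerD ?(rdot_le dVE)//.
by rewrite -!mulrA mulrCA ler_pdivlMl ?mulrA.
Qed.

End ErrorBound.

Section Convergence.
Variables (b : W) (x : V) (xa : R -> V).
Hypothesis Axb : A x = b.
Hypothesis xaE : forall a, 0 < a -> is_tikhonov A B b a (xa a).

(** With [u := xa a - xa c], subtracting the weak equations for [a] and [c]
    gives [(a - c) <xa c, u> = - |A u|^2 - a |u|^2], so [<xa c, u> >= 0] when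
    [a < c]; now expand [|xa a|^2 = |u + xa c|^2]. *)
Lemma rnorm_tikhonovB_sqr_le a c : 0 < a -> a <= c ->
  rnorm (xa c - xa a) ^+ 2 <= rnorm (xa a) ^+ 2 - rnorm (xa c) ^+ 2.
Proof.
move=> a0; rewrite le_eqVlt => /predU1P[<-|ac].
  by rewrite !subrr rnorm0 expr0n.
have c0 := lt_trans a0 ac; set u := xa a - xa c.
have ea := tikhonov_rdot u Axb (xaE a0).
have ec := tikhonov_rdot u Axb (xaE c0).
have uu : a * rdot dV (xa a) u - c * rdot dV (xa c) u = - rnorm (A u) ^+ 2.
  have uE : x - xa a - (x - xa c) = - u by rewrite opprB addrC subrKA opprB.
  by rewrite ea ec -rdotBl -linearB uE linearN rdotNl (rnorm_sqr dWE).
have xa_cu : xa a = u + xa c by rewrite subrK.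
clearbody u.
have xau : rdot dV (xa a) u = rdot dV (xa c) u + rnorm u ^+ 2.
  by rewrite xa_cu rdotDl (rnorm_sqr dVE) addrC.
have xcu : 0 <= rdot dV (xa c) u.
  have := sqr_ge0 (rnorm (A u)); have := sqr_ge0 (rnorm u).
  rewrite xau in uu; nra.
rewrite rnorm_distC xa_cu addrK (rnorm_sqr dVE (_ + _)) rdotDl !rdotDr.
rewrite -!(rnorm_sqr dVE) (rdotC dV u).
lra.
Qed.

(** The weak equation tested against [x - xa a] gives
    [<xa a, x - xa a> >= 0], that is [|xa a|^2 <= <xa a, x>]. *)
Lemma rnorm_tikhonov_le a : 0 < a -> rnorm (xa a) <= rnorm x.
Proof.
move=> a0; set u := x - xa a.
have e : a * rdot dV (xa a) u = rnorm (A u) ^+ 2.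
  by rewrite (tikhonov_rdot u Axb (xaE a0)) (rnorm_sqr dWE).
have : 0 <= rdot dV (xa a) u by rewrite -(pmulr_rge0 _ a0) e sqr_ge0.
rewrite rdotBr -(rnorm_sqr dVE) subr_ge0 => le1.
have := le_trans le1 (rdot_le dVE _ _).
have [->|xa0] := eqVneq (rnorm (xa a)) 0; first by rewrite rnorm_ge0.
by rewrite expr2 ler_pM2l// lt_neqAle eq_sym xa0 rnorm_ge0.
Qed.

End Convergence.

End Tikhonov.

(** The family [xa] is Cauchy because its norms increase to a finite supremum as
    [a] decreases to [0], and norm gaps control distances.  Its limit [l] is
    again a solution, and [x - l] lies both in the kernel of [A] and in its
    orthogonal complement. *)
Lemma tikhonov_cvg (R : realType) (k : scalar_kind)
    (V : completeNormedModType (scalars R k)) (W : normedModType (scalars R k))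
    (dV : {dot V for @sconj R k}) (dW : {dot W for @sconj R k})
    (dVE : norm_from_dot dV) (dWE : norm_from_dot dW)
    (A : {linear V -> W}) (B : W -> V) (b : W) (x : V) (xa : R -> V) :
  is_adjoint dV dW A B -> bounded_operator A ->
  is_min_norm_solution A b x ->
  (forall a, 0 < a -> is_tikhonov A B b a (xa a)) ->
  xa @ 0^'+ --> x.
Proof.
move=> AB /bounded_operator_ge0[M M0 AM] xmin xaE.
have Axb := xmin.1.
have /cvg_ex[l xal] : cvg (xa @ 0^'+).
  apply: cauchy_cvg; apply: cauchy_exP => e e0.
  have re0 := re_part_gt0 e0.
  pose E := [set rnorm (xa a) ^+ 2 | a in [set a | 0 < a]].
  have Eub : has_ubound E.
    exists (rnorm x ^+ 2) => _ [a /= a0 <-].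
    rewrite lerXn2r ?nnegrE ?rnorm_ge0//.
    exact: (rnorm_tikhonov_le dVE dWE AB Axb xaE).
  have Esup : has_sup E.
    by split => //; exists (rnorm (xa 1) ^+ 2), 1 => //=; exact: ltr01.
  (* below this [c] the squared norms vary by less than [|e|^2] *)
  have [|_ [c /= c0 <-] supc] := @sup_adherent _ E (re_part e ^+ 2) _ Esup.
    by rewrite exprn_gt0.
  exists (xa c).
  near=> a.
  have a0 : 0 < a by near: a; exact: nbhs_right_gt.
  have ac : a <= c by near: a; exact: nbhs_right_le.
  have xac : rnorm (xa a) ^+ 2 <= sup E.
    by apply: ub_le_sup => //; exists a.
  rewrite -ball_normE /= -rnormE -(of_real_re_part (ltW e0)) lt_of_real.
  rewrite -(@ltr_pXn2r _ 2) ?nnegrE ?rnorm_ge0 ?(ltW re0)//.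
  have := rnorm_tikhonovB_sqr_le dVE dWE AB Axb xaE a0 ac.
  lra.
have /cvg_rnormP xal0 := xal.
set u := x - l.
(* [|A u|^2 = <A (x - xa a), A u> - <A (l - xa a), A u>] is bounded by a
   quantity that vanishes with [a] *)
have Au0 : A u = 0.
  have le_a : \forall a \near (0 : R)^'+,
      rnorm (A u) ^+ 2 <=
      a * (rnorm x * rnorm u) + M * rnorm (l - xa a) * rnorm (A u).
    near=> a; have a0 : 0 < a by near: a; exact: nbhs_right_gt.
    have uE : u = (x - xa a) - (l - xa a) by rewrite opprB addrA subrK.
    rewrite (rnorm_sqr dWE) {1}uE linearB rdotBl.
    rewrite -(tikhonov_rdot AB u Axb (xaE a a0)).
    rewrite -rdotNl lerD//.
      rewrite ler_wpM2l ?(ltW a0)// (le_trans (rdot_le dVE _ _))//.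
      by rewrite ler_wpM2r ?rnorm_ge0// (rnorm_tikhonov_le dVE dWE AB Axb xaE).
    by rewrite (le_trans (rdot_le dWE _ _))// rnormN ler_wpM2r ?rnorm_ge0.
  have rhs0 : a * (rnorm x * rnorm u) + M * rnorm (l - xa a) * rnorm (A u)
      @[a --> (0 : R)^'+] --> 0 * (rnorm x * rnorm u) + M * 0 * rnorm (A u).
    apply: cvgD; first by apply: cvgMl; exact/cvg_at_right_filter/cvg_id.
    by apply: cvgMl; apply: cvgMr.
  have := cvgr_to_ge rhs0 le_a.
  rewrite mul0r mulr0 mul0r addr0 => le0; apply/rnorm_eq0/eqP.
  by rewrite -sqrf_eq0 eq_le le0 sqr_ge0.
(* [|u|^2 = <x, u> - <l, u> = <xa a - l, u>], as [x] and [xa a] are orthogonal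
   to [u] *)
have le_u : \forall a \near (0 : R)^'+, rnorm u <= rnorm (l - xa a).
  near=> a; have a0 : 0 < a by near: a; exact: nbhs_right_gt.
  have xau : rdot dV (xa a) u = 0.
    have := tikhonov_rdot AB u Axb (xaE a a0).
    by rewrite Au0 rdot0r => /eqP; rewrite mulf_eq0 gt_eqF//= => /eqP.
  have [->|u0] := eqVneq (rnorm u) 0; first exact: rnorm_ge0.
  have ugt0 : 0 < rnorm u by rewrite lt_neqAle eq_sym u0 rnorm_ge0.
  rewrite -(ler_pM2r ugt0) -expr2 (rnorm_sqr dVE) {1}/u rdotBl.
  rewrite (min_norm_orthogonal dVE xmin Au0) -xau -rdotBl rnorm_distC.
  exact: rdot_le.
have /rnorm_eq0/eqP : rnorm u = 0.
  by apply/le_anti; rewrite rnorm_ge0 (cvgr_to_ge xal0 le_u).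
by rewrite subr_eq0 => /eqP ->.
Unshelve. all: by end_near. Qed.

Theorem theorem2 (R : realType) (k : scalar_kind)
  (* Hilbert spaces X and Y over K = scalars R k *)
  (X Y : completeNormedModType (scalars R k))
  (dX : {dot X for @sconj R k}) (dY : {dot Y for @sconj R k})
  (dXE : norm_from_dot dX) (dYE : norm_from_dot dY)
  (* T : X -> Y bounded linear with adjoint Ts *)
  (T : {linear X -> Y}) (T_bounded : bounded_operator T)
  (Ts : Y -> X) (TsE : is_adjoint dX dY T Ts)
  (* the subspace Z (as a set S and as a space Z) contains the range of T *)
  (S : pred Y) (Z : subLmodType S)
  (TS : forall x : X, T x \in S)
  (y : Z) (y_range : exists x : X, T x = val y)
  (* finite dimensional inner product spaces Y_n *)
  (Yn : nat -> normedModType (scalars R k))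
  (dYn : forall n, {dot Yn n for @sconj R k})
  (dYnE : forall n, norm_from_dot (dYn n))
  (Yn_findim : forall n, finite_dimensional (Yn n))
  (p : forall n, {linear Z -> Yn n})
  (* T_n = p_n T is bounded, with adjoint Tns n *)
  (Tn_bounded : forall n, bounded_operator (comp_on TS (p n)))
  (Tns : forall n, Yn n -> X)
  (TnsE : forall n, is_adjoint dX (dYn n) (comp_on TS (p n)) (Tns n))
  (* minimal norm solutions and Tikhonov regularized solutions *)
  (xd : X) (xdE : is_min_norm_solution T (val y) xd)
  (xnd : nat -> X)
  (xndE : forall n, is_min_norm_solution (comp_on TS (p n)) (p n y) (xnd n))
  (xa : R -> X)
  (xaE : forall a : R, 0 < a -> is_tikhonov T Ts (val y) a (xa a))
  (eps : nat -> R) (eps_gt0 : forall n, 0 < eps n)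
  (eps_bound : forall n,
    opnorm (fun x : X => Ts (T x) - Tns n (comp_on TS (p n) x)) <= eps n) :
  (forall (n : nat) (a : R), 0 < a ->
     rnorm (xd - xnd n) <= (1 + eps n / a) * rnorm (xd - xa a)) /\
  (forall n : nat, rnorm (xd - xnd n) <= 2 * rnorm (xd - xa (eps n))) /\
  ((fun n => opnorm (fun x : X => Ts (T x) - Tns n (comp_on TS (p n) x)))
     @ \oo --> (0 : R) ->
   (fun n => rnorm (xd - xnd n)) @ \oo --> (0 : R)).
Proof.
pose Tn n : {linear X -> Yn n} := comp_on TS (p n).
have Tnxd n : Tn n xd = p n y.
  by congr (p n _); apply: val_inj; rewrite SubK xdE.1.
have bound n a : 0 < a -> rnorm (xd - xnd n) <=
    (1 + opnorm (fun x => Ts (T x) - Tns n (Tn n x)) / a) * rnorm (xd - xa a).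
  move=> a0; apply: (min_norm_error_le dXE dYE TsE (dYnE n) (A' := Tn n)).
  - exact: TnsE.
  - by [].
  - exact: Tn_bounded.
  - exact: a0.
  - by rewrite Tnxd; exact: xndE.
  - by rewrite xdE.1; exact: xaE.
have bound2 n a c : 0 < a ->
    opnorm (fun x => Ts (T x) - Tns n (Tn n x)) <= c ->
    rnorm (xd - xnd n) <= (1 + c / a) * rnorm (xd - xa a).
  move=> a0 le_c; rewrite (le_trans (bound n a a0))// ler_wpM2r ?rnorm_ge0//.
  by rewrite lerD2l ler_wpM2r ?invr_ge0 ?(ltW a0).
split; first by move=> n a a0; exact: bound2 (eps_bound n).
split.
  move=> n; have -> : 2 = 1 + eps n / eps n :> R.
    by rewrite divff ?gt_eqF// -(natrD _ 1 1).
  exact: bound2 (eps_bound n).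
move=> opn0.
have /cvg_rnormP/cvgrPdist_lt xa_xd :=
  tikhonov_cvg dXE dYE TsE T_bounded xdE xaE.
apply/cvgrPdist_le => e e0.
have e20 : 0 < e / 2 by rewrite divr_gt0.
near (0 : R)^'+ => a.
have a0 : 0 < a by near: a; exact: nbhs_right_gt.
have xae : `|0 - rnorm (xd - xa a)| < e / 2 by near: a; exact: xa_xd.
move/cvgrPdist_le : opn0 => /(_ a a0); apply: filterS => n.
rewrite !sub0r !normrN => opna; rewrite ger0_norm ?rnorm_ge0//.
rewrite (le_trans (bound2 n a a a0 (le_trans (ler_norm _) opna)))//.
move: xae; rewrite sub0r normrN ger0_norm ?rnorm_ge0// divff ?gt_eqF// => xae.
by lra.
Unshelve. all: by end_near. Qed.
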